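(* For any $x\in\mathbb{R}^\kappa$ and $k\in\{1,2\}$, let $\Phi_k(x)=\sup_{t\ge0}\,(e^{At}x)^{k,1}$. Then $$\Phi_k(x)\le\tilde\Phi_k(x):=\max_{j=1,\dots,\eta_k+1}\left\{0,\frac{x^{k,j}}{\nu_k^{j-1}}\right\}.$$
   Context: Parameters: integers $\eta_1,\eta_2\ge1$, reals $\nu_1,\nu_2>0$, $\kappa=\eta_1+\eta_2+2$. A vector $x\in\mathbb{R}^\kappa$ is written $x=(x^1,x^2)$ with $x^k=(x^{k,1},\dots,x^{k,\eta_k+1})\in\mathbb{R}^{\eta_k+1}$. $A\in\mathbb{R}^{\kappa\times\kappa}$ is block-diagonal with blocks $A_{\nu_1},A_{\nu_2}$, where $A_{\nu_k}$ is the $(\eta_k+1)\times(\eta_k+1)$ matrix with $-\nu_k$ on the diagonal, $1$ on the first superdiagonal and $0$ elsewhere. The maximum is over the set consisting of $0$ and all the numbers $x^{k,j}/\nu_k^{j-1}$, $1\le j\le\eta_k+1$. *)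

(* Defs.v *)
From mathcomp Require Import all_boot all_order all_algebra.
From mathcomp Require Import all_classical all_reals all_analysis.
Import Order.TTheory GRing.Theory Num.Theory.
Import numFieldNormedType.Exports.

Set Implicit Arguments.
Unset Strict Implicit.
Unset Printing Implicit Defensive.

Local Open Scope classical_set_scope.
Local Open Scope ring_scope.

(* The limit is taken in the normed topology of 'M[R]_n. *)
Definition expmx (R : realType) (n : nat) (M : 'M[R]_n) : 'M[R]_n :=
  limn (series (fun i : nat => (i`!%:R)^-1 *: M ^+ i)).

(* The two blocks are indexed by k : 'I_2, so that
   kappa eta = (eta 0).+1 + (eta 1).+1. *)
Definition kappa (eta : 'I_2 -> nat) : nat := (\sum_(k < 2) (eta k).+1)%N.

Definition Ablock (R : realType) (m : nat) (nu : R) : 'M[R]_m :=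
  \matrix_(i < m, j < m)
    (if j == i :> nat then - nu else if j == i.+1 :> nat then 1 else 0).

Definition Amx (R : realType) (eta : 'I_2 -> nat) (nu : 'I_2 -> R) :
    'M[R]_(kappa eta) :=
  \mxdiag_(k < 2) Ablock (eta k).+1 (nu k).

(* Coordinates are numbered from 0: coord x k j is x^{k,j+1}. *)
Definition coord (R : realType) (eta : 'I_2 -> nat) (x : 'cV[R]_(kappa eta))
    (k : 'I_2) (j : 'I_(eta k).+1) : R :=
  (submxcol x k : 'cV[R]_(eta k).+1) j 0.

(* The supremum is taken in the extended reals: sup on R would be 0 on an
   unbounded set. *)
Definition Phi (R : realType) (eta : 'I_2 -> nat) (nu : 'I_2 -> R)
    (k : 'I_2) (x : 'cV[R]_(kappa eta)) : \bar R :=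
  ereal_sup [set (coord (expmx (t *: Amx eta nu) *m x) (ord0 : 'I_(eta k).+1))%:E
            | t in [set t : R | 0 <= t]].

Definition Phit (R : realType) (eta : 'I_2 -> nat) (nu : 'I_2 -> R)
    (k : 'I_2) (x : 'cV[R]_(kappa eta)) : R :=
  \big[Num.max/0]_(j < (eta k).+1) (coord x j / nu k ^+ j).

(* Main.v *)
(* The first row of exp(t A_nu) is (exp(- nu t) t^j / j!)_j.  Bounding each
   x^{k,j} by nu^j times the maximum M leaves
   M exp(- nu t) \sum_j (nu t)^j / j! <= M. *)
Require Import Defs.
From mathcomp Require Import all_boot all_order all_algebra.
From mathcomp Require Import all_classical all_reals all_analysis.
From mathcomp Require Import ring.
Import Order.TTheory GRing.Theory Num.Theory.
Import numFieldNormedType.Exports.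
Local Open Scope ring_scope.

(** A block is -nu times the identity plus a nilpotent shift, so the binomial theorem gives the
    first row of its powers ([Ablock_exp_row0]). Summing the exponential series along that row
    yields t^j/j! e^(-nu t) ([series_exp_binom_cvg]). As the big matrix acts blockwise
    ([mxdiag_exp_mul]), the coordinate under study is a combination of the x^{k,j} with these
    weights ([coord_expmx0]). For t >= 0 the weights are nonnegative, so each coordinate may be
    replaced by its bound M nu^j, M being the maximum. What remains is M e^(-nu t) times a partial
    sum of the series of e^(nu t), at most M because M >= 0. *)

Lemma cvg_mx_entry (R : realType) (m n : nat) (u : nat -> 'M[R]_(m, n))
    (M : 'M[R]_(m, n)) :
  (forall i j, (fun N => u N i j) @ \oo --> M i j)%classic ->
  (u @ \oo --> M)%classic.
Proof.
move=> uM A [P MP PA].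
have : (\forall N \near \oo, forall i j, P i j (u N i j))%classic.
  by apply: filter_forall => i; apply: filter_forall => j; exact: uM.
by apply: filterS => N PN; exact: PA.
Qed.

Lemma ler_norm_mx_exp (R : realType) (n : nat) (M : 'M[R]_n) (c : R)
    (N : nat) (i j : 'I_n) :
  (forall k l, `|M k l| <= c) -> `|(M ^+ N) i j| <= (n%:R * c) ^+ N.
Proof.
move=> Mc; elim: N i j => [|N IH] i j.
  rewrite expr0 mxE expr0.
  by case: eqP => _; rewrite ?normr1 ?normr0 ?ler01.
rewrite exprSr -[_ * M]/(_ *m M) mxE (le_trans (ler_norm_sum _ _ _))//.
apply: (@le_trans _ _ (\sum_(k < n) (n%:R * c) ^+ N * c)).
  by apply: ler_sum => k _; rewrite normrM ler_pM ?IH ?Mc.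
by rewrite sumr_const card_ord exprSr mulrCA [leRHS]mulr_natl.
Qed.

(** A [limn] carries information only once convergence is known. With c the sum of the absolute
    values of the entries of M, each entry of the series is dominated by the scalar exponential
    series of n c. *)
Lemma expmx_cvg (R : realType) (n : nat) (M : 'M[R]_n) :
  (series (fun i : nat => (i`!%:R)^-1 *: M ^+ i) @ \oo --> expmx M)%classic.
Proof.
pose c : R := \sum_i \sum_j `|M i j|.
have c0 : 0 <= c by apply: sumr_ge0 => i _; apply: sumr_ge0.
have Mc k l : `|M k l| <= c.
  rewrite /c (bigD1 k)//= (bigD1 l)//= -addrA lerDl addr_ge0//.
    by apply: sumr_ge0.
  by apply: sumr_ge0 => i _; apply: sumr_ge0.
have ent_cvg i j : cvgn (series (fun N : nat => (N`!%:R)^-1 * (M ^+ N) i j)).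
  apply: normed_cvg.
  apply: (@series_le_cvg _ _ (exp_coeff (n%:R * c))) => [N|N|N|].
  - exact: normr_ge0.
  - by apply: exp_coeff_ge0; rewrite mulr_ge0.
  - rewrite /exp_coeff/= normrM ger0_norm ?invr_ge0// mulrC.
    rewrite ler_wpM2r ?invr_ge0//.
    exact: ler_norm_mx_exp.
  - exact: is_cvg_series_exp_coeff.
apply: (@cvgP _ _ (\matrix_(i, j)
  limn (series (fun N : nat => (N`!%:R)^-1 * (M ^+ N) i j)))).
apply: cvg_mx_entry => i j; rewrite mxE.
rewrite [X in (X @ _)%classic](_ : _ =
  series (fun N : nat => (N`!%:R)^-1 * (M ^+ N) i j)); first exact: ent_cvg.
apply/funext => N; rewrite /series/= summxE.
by apply: eq_bigr => k _; rewrite mxE.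
Qed.

Lemma expmx_mul_cvg (R : realType) (n : nat) (M : 'M[R]_n) (x : 'cV[R]_n)
    (p : 'I_n) :
  (series (fun i : nat => (i`!%:R)^-1 * (M ^+ i *m x) p 0) @ \oo -->
    (expmx M *m x) p 0)%classic.
Proof.
rewrite [X in (X @ _)%classic](_ : _ = fun N : nat =>
  \sum_q series (fun i : nat => (i`!%:R)^-1 *: M ^+ i) N p q * x q 0).
  rewrite mxE.
  apply: cvg_big => [|q _]; first exact: add_continuous.
  apply: cvgMr_tmp.
  exact: (continuous_cvg _ (@coord_continuous _ _ _ p q _) (@expmx_cvg R n M)).
apply/funext => N.
rewrite /series/=.
under [RHS]eq_bigr do rewrite summxE mulr_suml.
rewrite exchange_big/=; apply: eq_bigr => i _.
rewrite mxE mulr_sumr; apply: eq_bigr => q _.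
by rewrite mxE mulrA.
Qed.

(** Column j+1 of the block has only the entries 1 (row j) and -nu (row j+1), so the induction step
    is Pascal's rule. *)
Lemma Ablock_exp_row0 (R : realType) (m : nat) (nu : R) (i : nat)
    (j : 'I_m.+1) :
  (Ablock m.+1 nu ^+ i) ord0 j = 'C(i, j)%:R * (- nu) ^+ (i - j).
Proof.
elim: i j => [|i IH] j.
  by rewrite expr0 mxE bin0n sub0n expr0 mulr1 eq_sym.
rewrite exprSr -[_ * Ablock _ _]/(_ *m _) mxE.
under eq_bigr do rewrite IH mxE.
case: j => -[|j] jm /=.
  rewrite (bigD1 ord0)//= big1 => [|l /negPf l0].
    by rewrite !bin0 !subn0 !mul1r addr0 -exprSr.
  by rewrite eq_sym -[_ == 0%N]/(l == ord0) l0 mulr0.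
have jm' : (j < m.+1)%N by exact: ltnW.
rewrite (bigD1 (Ordinal jm))//= eqxx (bigD1 (Ordinal jm'))/=; last first.
  by rewrite -val_eqE/= ltn_eqF.
rewrite gtn_eqF// eqxx mulr1 big1 => [|l /andP[lj lj']]; last first.
  rewrite eq_sym -[_ == j.+1]/(l == Ordinal jm) (negPf lj) eqSS eq_sym.
  by rewrite -[_ == j]/(l == Ordinal jm') (negPf lj') mulr0.
rewrite addr0 binS natrD mulrDl subSS.
congr (_ + _).
(* When i <= j the subtraction in the exponent truncates, but the binomial coefficient is then 0. *)
have [ij|ij] := ltnP j i; last by rewrite bin_small ?ltnS// !mul0r.
by rewrite -mulrA -exprSr subnSK.
Qed.

Lemma series_exp_binom_cvg (R : realType) (t nu : R) (j : nat) :
  (series (fun i : nat => (i`!%:R)^-1 *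
     (t ^+ i * ('C(i, j)%:R * (- nu) ^+ (i - j)))) @ \oo -->
   exp_coeff t j * expR (- nu * t))%classic.
Proof.
(* The terms with i < j vanish; after a shift by j, C(i+j, j)/(i+j)! = 1/(i! j!) factors out
   t^j/j!. *)
rewrite -(cvg_shiftn j).
rewrite [X in (X @ _)%classic](_ : _ = fun N : nat =>
    exp_coeff t j * series (exp_coeff (- nu * t)) N); last first.
  apply/funext => N; rewrite /series/= addnC.
  rewrite (@big_cat_nat _ _ _ j)//= ?leq_addr// big_nat big1 ?add0r; last first.
    by move=> i /= ij; rewrite bin_small// mul0r !mulr0.
  rewrite -{1}[j]add0n big_addn addKn mulr_sumr; apply: eq_bigr => i _.
  rewrite addnK /exp_coeff/= exprMn.
  rewrite -(@bin_fact (i + j) j) ?leq_addl// addnK.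
  rewrite !natrM exprD.
  have bneq : ('C(i + j, j)%:R : R) != 0.
    by rewrite pnatr_eq0 -lt0n bin_gt0 leq_addl.
  have fneq k : (k`!%:R : R) != 0 by rewrite pnatr_eq0 -lt0n fact_gt0.
  by field; rewrite bneq !fneq.
apply: cvgMl_tmp.
exact: is_cvg_series_exp_coeff.
Qed.

Lemma sum_exp_coeff_le_expR (R : realType) (y : R) (n : nat) :
  0 <= y -> \sum_(j < n) exp_coeff y j <= expR y.
Proof.
move=> y0; rewrite -(big_mkord xpredT (exp_coeff y)).
apply: (nondecreasing_cvgn_le _ (is_cvg_series_exp_coeff y)).
apply/nondecreasing_seqP => k.
by rewrite /series/= big_nat_recr//= lerDl exp_coeff_ge0.
Qed.

Lemma mxdiag_exp_mul (R : realType) (p : nat) (d : 'I_p -> nat)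
    (B : forall k, 'M[R]_(d k)) (t : R) (x : 'cV[R]_(\sum_k d k)) (i : nat) :
  (t *: \mxdiag_k B k) ^+ i *m x =
  t ^+ i *: \mxcol_k (B k ^+ i *m submxcol x k).
Proof.
elim: i => [|i IH].
  rewrite !expr0 scale1r mul1mx -{1}[x]submxcolK.
  by apply/eq_mxcolP => k; rewrite expr0 mul1mx.
rewrite exprS -[_ * _]/(_ *m _) -mulmxA IH -scalemxAr -scalemxAl.
rewrite mul_mxdiag_mxcol scalerA -exprSr.
congr (_ *: _); apply/eq_mxcolP => k.
by rewrite exprS mulmxA.
Qed.

Lemma coord_expmx0 (R : realType) (eta : 'I_2 -> nat) (nu : 'I_2 -> R)
    (x : 'cV[R]_(kappa eta)) (k : 'I_2) (t : R) :
  Defs.coord (expmx (t *: Amx eta nu) *m x) (ord0 : 'I_(eta k).+1) =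
  \sum_(j < (eta k).+1) exp_coeff t j * expR (- nu k * t) * Defs.coord x j.
Proof.
rewrite {1}/Defs.coord mxE.
set p := tagnat.Rank _ _.
have := @expmx_mul_cvg R _ (t *: Amx eta nu) x p.
(* By uniqueness of limits, it suffices that the same series also converges to the right-hand
   side. *)
move=> /(cvg_lim (@Rhausdorff R)) <-; apply/cvg_lim; first exact: Rhausdorff.
rewrite [X in (X @ _)%classic](_ : _ = fun N : nat =>
  \sum_(j < (eta k).+1) series (fun i : nat => (i`!%:R)^-1 *
     (t ^+ i * ('C(i, j)%:R * (- nu k) ^+ (i - j)))) N * Defs.coord x j).
  apply: cvg_big => [|j _]; first exact: add_continuous.
  apply: cvgMr_tmp.
  exact: series_exp_binom_cvg.
apply/funext => N.
rewrite /series/=.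
under [RHS]eq_bigr do rewrite mulr_suml.
rewrite exchange_big/=; apply: eq_bigr => i _.
(* [p] is the position, in the whole vector, of the first entry of block [k]. *)
have rowp (C : forall l, 'cV[R]_(eta l).+1) : (\mxcol_l C l) p 0 = C k ord0 0.
  by rewrite -[in RHS](mxcolK C k) [RHS]mxE.
rewrite /Amx mxdiag_exp_mul [X in _ * X]mxE.
rewrite (rowp (fun l => Ablock (eta l).+1 (nu l) ^+ i *m submxcol x l)).
rewrite mxE !mulr_sumr; apply: eq_bigr => j _.
by rewrite Ablock_exp_row0 !mulrA.
Qed.

Theorem lemma3 (R : realType) (eta : 'I_2 -> nat) (nu : 'I_2 -> R)
    (heta : forall k : 'I_2, (1 <= eta k)%N)
    (hnu : forall k : 'I_2, 0 < nu k)
    (x : 'cV[R]_(kappa eta)) (k : 'I_2) :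
  (Phi nu k x <= (Phit nu k x)%:E)%E.
Proof.
apply: ge_ereal_sup => _ [t /= t0 <-]; rewrite lee_fin coord_expmx0.
have nu0 := hnu k.
have M0 : 0 <= Phit nu k x by exact: bigmax_ge_id.
have coord_le (j : 'I_(eta k).+1) : Defs.coord x j <= Phit nu k x * nu k ^+ j.
  by rewrite -ler_pdivrMr ?exprn_gt0//; exact: le_bigmax.
apply: (@le_trans _ _ (\sum_(j < (eta k).+1)
    Phit nu k x * expR (- nu k * t) * exp_coeff (nu k * t) j)).
  apply: ler_sum => j _.
  rewrite [leRHS](_ : _ = exp_coeff t j * expR (- nu k * t) *
    (Phit nu k x * nu k ^+ j)).
    by rewrite ler_wpM2l// mulr_ge0 ?exp_coeff_ge0 ?expR_ge0.
  by rewrite /exp_coeff/= exprMn; ring.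
rewrite -mulr_sumr -mulrA ler_piMr// mulNr expRN.
rewrite ler_pdivrMl ?expR_gt0// mulr1.
by rewrite sum_exp_coeff_le_expR// mulr_ge0// ltW.
Qed.
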